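(* Let $A_\bullet=(A_k)_{k=0}^\infty$ be a sequence of matrices in $\mathbb{C}^{d\times d}$ and $S\in\mathbb{C}^{d\times d}$. If $\sum_{k=0}^\infty A_k$ is Cesàro summable to $S$, then $\sum_{k=0}^\infty A_k$ is Abel summable to $S$.
   Context: For a sequence $(A_k)_{k=0}^\infty$ in $\mathbb{C}^{d\times d}$ put $S_n=\sum_{k=0}^nA_k$ and $\Sigma_n=\frac1n\sum_{k=0}^{n-1}S_k$ for $n\ge1$. The series $\sum_{k=0}^\infty A_k$ is Cesàro summable to $S$ if $\lim_{n\to\infty}\Sigma_n=S$. It is Abel summable to $S$ if $\sum_{k=0}^\infty A_kx^k$ is conventionally summable (its partial sums converge) for all $x\in(0,1)$ and $\lim_{x\to1^-}\sum_{k=0}^\infty A_kx^k=S$. Limits are in any matrix norm. *)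

(* Defs.v *)
From HB Require Import structures.
From mathcomp Require Import all_boot all_order all_algebra.
From mathcomp Require Import all_classical all_reals all_analysis.
From mathcomp Require Import complex.

Set Implicit Arguments.
Unset Strict Implicit.
Unset Printing Implicit Defensive.

Import Order.TTheory GRing.Theory Num.Theory.
Import numFieldNormedType.Exports.

Local Open Scope classical_set_scope.
Local Open Scope ring_scope.
Local Open Scope complex_scope.

(* Gives C = R[i] the topology of its modulus, so that 'M[R[i]]_d gets the
   library's entrywise maximum norm.  All norms on 'M[R[i]]_d being equivalent,
   the limits below are the limits in any matrix norm. *)
HB.instance Definition _ (R : realType) := NormedModule.copy R[i] R[i]^o.

Section Summability.
Variables (R : realType) (d : nat).
Implicit Types (A : nat -> 'M[R[i]]_d) (S : 'M[R[i]]_d).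

(* Unlike the library's [series], the sum includes the term of index n. *)
Definition partial_sum A (n : nat) : 'M[R[i]]_d := \sum_(0 <= k < n.+1) A k.

(* The value at n = 0 is junk and irrelevant to the limit. *)
Definition cesaro_mean A (n : nat) : 'M[R[i]]_d :=
  n%:R^-1 *: \sum_(0 <= k < n) partial_sum A k.

Definition cesaro_summable A S : Prop :=
  cesaro_mean A n @[n --> \oo] --> S.

Definition power_term A (x : R) (k : nat) : 'M[R[i]]_d := (x ^+ k)%:C *: A k.

Definition power_sum A (x : R) : 'M[R[i]]_d :=
  limn (partial_sum (power_term A x)).

(* [limn] is total; the first conjunct makes [power_sum A x] the actual sum for
   every x that matters in the left limit at 1. *)
Definition abel_summable A S : Prop :=
  (forall x : R, 0 < x < 1 -> cvgn (partial_sum (power_term A x))) /\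
  power_sum A x @[x --> (1 : R)^'-] --> S.

End Summability.

(* Main.v *)
Require Import Defs.
From mathcomp Require Import all_boot all_order all_algebra.
From mathcomp Require Import all_classical all_reals all_analysis.
From mathcomp Require Import complex ring lra.

(** Cesàro summability implies Abel summability because the Abel sums are
weighted averages of the Cesàro means, with weights that move off to infinity
as x tends to 1.

For a real series with partial sums S_k and T_n = S_0 + ... + S_(n-1), two
summations by parts ([sum_by_parts_power]) turn the partial sum of
sum a_k x^k into (1-x)^2 sum T_(k+1) x^k plus boundary terms which, because
T_n / n converges and n x^n tends to 0, vanish in the limit.  Writing T_(k+1)
as k+1 times the Cesàro mean t_k, this is the identity
  sum_k a_k x^k = sum_k w_k(x) t_k,   w_k(x) = (1-x)^2 (k+1) x^k
([partial_sums_cvg_abel_average]).  The weights w_k(x) are nonnegative and add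
up to 1, and each of them tends to 0 as x tends to 1 from the left.  Hence if
t_k is within e of s from rank N on, the average is within
e + sum_(k < N) w_k(x) |t_k - s| of s, and the finite sum vanishes in the limit
([abel_average_cvg]).

Convergence of complex matrices is convergence of the real and imaginary parts
of all the entries ([cvg_mxP], [cvg_complexP]).  Taking such a part commutes
with sums and with multiplication by a real number, hence with the formation of
Cesàro means and of power sums at a real x, so the matrix statement follows
from the real one ([cesaro_abel_real]) one coordinate at a time.  Working
coordinatewise also makes completeness of the real numbers the only
completeness involved. *)
Set Implicit Arguments.
Unset Strict Implicit.
Unset Printing Implicit Defensive.

Import Order.TTheory GRing.Theory Num.Theory.
Import numFieldNormedType.Exports.
Local Open Scope classical_set_scope.
Local Open Scope ring_scope.
Local Open Scope complex_scope.

(** * Summation by parts and the Abel weights *)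

Lemma sum_by_parts_power (K : comNzRingType) (u : nat -> K) (x : K) n :
  \sum_(0 <= k < n) x ^+ k * u k =
  (1 - x) * (\sum_(0 <= k < n) x ^+ k * series u k.+1) + x ^+ n * series u n.
Proof.
elim: n => [|n IHn]; first by rewrite /series /= !big_geq// !mulr0 addr0.
rewrite !big_nat_recr//= IHn.
have -> : series u n.+1 = series u n + u n by rewrite /series /= big_nat_recr.
rewrite exprS; ring.
Qed.

(** The weight of the k-th Cesàro mean in the Abel sum: the two factors [1 - x]
come from the two summations by parts, the factor [k.+1] from the
normalization of the mean. *)
Definition abel_weight {K : comNzRingType} (x : K) (k : nat) : K :=
  (1 - x) ^+ 2 * (k.+1%:R * x ^+ k).

(** This closed form carries both the bound and the limit of the total mass. *)
Lemma sum_abel_weight (K : comNzRingType) (x : K) n :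
  \sum_(0 <= k < n) abel_weight x k = 1 - x ^+ n - (1 - x) * (n%:R * x ^+ n).
Proof.
elim: n => [|n IHn]; first by rewrite big_geq// mul0r mulr0 subr0 subrr.
by rewrite big_nat_recr//= IHn /abel_weight -natr1 (exprS x n); ring.
Qed.

Lemma cvgMl0 (K : numFieldType) (T : Type) (F : set_system T) {FF : Filter F}
    (c : K) (f : T -> K) :
  f x @[x --> F] --> 0 -> c * f x @[x --> F] --> 0.
Proof. by move=> f0; rewrite -[X in _ --> X](mulr0 c); exact: cvgMl_tmp. Qed.

Section unit_interval.
Variables (R : realType) (x : R).
Hypothesis x01 : 0 < x < 1.

Let x0 : 0 < x. Proof. by case/andP: x01. Qed.
Let x1 : x < 1. Proof. by case/andP: x01. Qed.

Lemma abel_weight_ge0 k : 0 <= abel_weight x k.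
Proof. by rewrite mulr_ge0 ?sqr_ge0// mulr_ge0// exprn_ge0// ltW. Qed.

Lemma sum_abel_weight_le1 n : \sum_(0 <= k < n) abel_weight x k <= 1.
Proof.
rewrite sum_abel_weight.
have xn0 : 0 <= x ^+ n by rewrite exprn_ge0// ltW.
have : 0 <= (1 - x) * (n%:R * x ^+ n).
  by rewrite mulr_ge0 ?mulr_ge0// subr_ge0 ltW.
lra.
Qed.

Lemma is_cvg_series_abel_weight : cvgn (series (abel_weight x)).
Proof.
apply: nondecreasing_is_cvgn.
  by apply: nondecreasing_series => n _ _; exact: abel_weight_ge0.
by exists 1 => _ [n _ <-]; exact: sum_abel_weight_le1.
Qed.

(** [n * x ^ n] is, up to a constant factor and a shift, the general term of the
convergent series of weights. *)
Lemma cvg_natmul_expr : n%:R * x ^+ n @[n --> \oo] --> 0.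
Proof.
have /cvg_series_cvg_0 w0 := is_cvg_series_abel_weight.
rewrite -cvg_shiftS /=.
have x2 : (1 - x) ^+ 2 != 0 by rewrite expf_neq0// subr_eq0 gt_eqF.
have -> : (fun n => n.+1%:R * x ^+ n.+1) =
          (fun n => (x / (1 - x) ^+ 2) * abel_weight x n).
  apply/funext => n; rewrite /abel_weight exprS.
  by field; rewrite expf_neq0// subr_eq0 gt_eqF in x2 *.
by apply: cvgMl0; exact: w0.
Qed.

Lemma cvg_series_abel_weight : series (abel_weight x) @ \oo --> (1 : R).
Proof.
rewrite [series _](_ : _ =
    fun n => 1 - x ^+ n - (1 - x) * (n%:R * x ^+ n)); last first.
  by apply/funext => n; exact: sum_abel_weight.
have x0' : x ^+ n @[n --> \oo] --> 0 by apply: cvg_expr; rewrite ger0_norm// ltW.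
rewrite -[X in _ --> X]subr0; apply: cvgB.
  by rewrite -[X in _ --> X]subr0; apply: cvgB; [exact: cvg_cst|].
exact: cvgMl0 cvg_natmul_expr.
Qed.

Lemma is_cvg_series_abel_weightM (t : R ^nat) : cvgn t ->
  cvgn (series (fun k => abel_weight x k * t k)).
Proof.
move=> /cvg_seq_bounded[M [_ tM]]; apply: normed_cvg.
have {}tM k : `|t k| <= M + 1 by apply: tM; rewrite // ltrDl.
have M0 : 0 <= M + 1 by exact: le_trans (normr_ge0 (t 0%N)) (tM 0%N).
apply: (@series_le_cvg _ _ (fun k => (M + 1) * abel_weight x k)) => [k|k|k|].
- exact: normr_ge0.
- by rewrite mulr_ge0// abel_weight_ge0.
- rewrite /= normrM (ger0_norm (abel_weight_ge0 k)) mulrC.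
  by rewrite ler_wpM2r// abel_weight_ge0.
- exact: (@is_cvg_seriesZ _ (abel_weight x)) is_cvg_series_abel_weight.
Qed.

(** The tail, where [`|t k| <= e], contributes at most [e] since the total mass
is at most 1; the head keeps only the factor [(1 - x) ^+ 2], each [x ^+ k]
being at most 1, so that it vanishes at [x = 1]. *)
Lemma series_abel_weightM_le (t : R ^nat) (e : R) (N n : nat) :
  (forall k, (N <= k)%N -> `|t k| <= e) -> (N <= n)%N ->
  `|series (fun k => abel_weight x k * t k) n| <=
  (1 - x) ^+ 2 * (\sum_(0 <= k < N) k.+1%:R * `|t k|) + e.
Proof.
move=> te Nn; apply: (le_trans (ler_norm_sum _ _ _)).
rewrite (big_cat_nat (leq0n N) Nn)//=; apply: lerD.
  rewrite mulr_sumr; apply: ler_sum => k _.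
  rewrite normrM (ger0_norm (abel_weight_ge0 k)) /abel_weight -mulrA.
  rewrite ler_wpM2l ?sqr_ge0// -mulrA ler_wpM2l// ler_piMl//.
  by rewrite exprn_ile1 ?(ltW x0) ?(ltW x1).
have e0 : 0 <= e by exact: le_trans (normr_ge0 (t N)) (te N (leqnn N)).
have [Sle1 w0] := (sum_abel_weight_le1 n, abel_weight_ge0).
apply: (@le_trans _ _ ((\sum_(N <= k < n) abel_weight x k) * e)).
  rewrite mulr_suml [leLHS]big_nat_cond [leRHS]big_nat_cond.
  apply: ler_sum => k /andP[/andP[Nk _] _].
  by rewrite normrM (ger0_norm (w0 k)) ler_wpM2l// te.
rewrite ler_piMl//; apply: le_trans Sle1.
by rewrite (big_cat_nat (leq0n N) Nn)//= lerDr sumr_ge0.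
Qed.

End unit_interval.

Lemma near_left1 (R : numFieldType) : \forall x \near (1 : R)^'-, 0 < x < 1.
Proof.
near=> x; apply/andP.
by split; near: x; [exact: nbhs_left_gt|exact: nbhs_left_lt].
Unshelve. all: by end_near. Qed.

(** * The real case *)

(** A regularity statement in the sense of Toeplitz: the weights have total mass
1 and the mass of any initial segment of indices vanishes as x tends to 1. *)
Lemma abel_average_cvg (R : realType) (t : R ^nat) (s : R) :
  t @ \oo --> s ->
  limn (series (fun k => abel_weight x k * t k)) @[x --> 1^'-] --> s.
Proof.
move=> ts; apply/cvgrPdist_le => e e0.
have e20 : 0 < e / 2 by rewrite divr_gt0.
have [N _ tN] : \forall k \near \oo, `|t k - s| <= e / 2.
  by move/cvgrPdistC_le : ts; exact.
set C := \sum_(0 <= k < N) k.+1%:R * `|t k - s|.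
have Ce : \forall x \near (1 : R)^'-, (1 - x) ^+ 2 * C <= e / 2.
  suff : (1 - x) ^+ 2 * C @[x --> (1 : R)^'-] --> (1 - 1) ^+ 2 * C.
    rewrite subrr expr0n mul0r /= => /cvgr_le; apply.
    exact: e20.
  apply: cvg_at_left_filter; apply: cvgMr_tmp.
  by apply: cvgM; apply: cvgB => //; exact: cvg_cst.
near=> x.
have x01 : 0 < x < 1 by near: x; exact: near_left1.
have cvgt := is_cvg_series_abel_weightM x01 (cvgP _ ts).
(* As the weights have sum 1, averaging [t k - s] subtracts [s] from the
   average of [t]. *)
have cvgd : series (fun k => abel_weight x k * (t k - s)) @ \oo -->
    limn (series (fun k => abel_weight x k * t k)) - 1 * s.
  rewrite [series _](_ : _ = fun n => series (fun k => abel_weight x k * t k) n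
      - series (abel_weight x) n * s); last first.
    apply/funext => n; rewrite /series /= mulr_suml -sumrB.
    by apply: eq_bigr => k _; rewrite mulrBr.
  by apply: cvgB => //; apply: cvgMr_tmp; exact: cvg_series_abel_weight.
rewrite distrC -[X in _ - X]mul1r.
(* It is enough to bound the partial sums, those of rank at least [N]. *)
have ncvg := cvg_norm cvgd _.
apply: (ler_cvg_to (ncvg _) (cvg_cst e)).
exists N => // n /= Nn; apply: (le_trans (series_abel_weightM_le x01 tN Nn)).
rewrite [leRHS](splitr e) lerD2r; near: x; exact: Ce.
Unshelve. all: by end_near. Qed.

(** Abel sums are weighted averages of Cesàro means.  The mean of index 0 has no
weight, whence the shifted sequence [t]. *)
Lemma partial_sums_cvg_abel_average (R : realType) (a : R ^nat) (s : R) :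
  n%:R^-1 * series (fun k => series a k.+1) n @[n --> \oo] --> s ->
  forall x : R, 0 < x < 1 ->
  let t n := n.+1%:R^-1 * series (fun k => series a k.+1) n.+1 in
  series (fun k => x ^+ k * a k) @ \oo -->
  limn (series (fun k => abel_weight x k * t k)).
Proof.
set T := series (fun k => series a k.+1) => cs x x01 t.
have ts : t @ \oo --> s by move: cs; rewrite -cvg_shiftS.
have cvgt := is_cvg_series_abel_weightM x01 (cvgP _ ts).
(* Both boundary terms are controlled by [n * x ^ n] times the Cesàro mean:
   the one in [T] directly, the one in [series a] as a difference of those
   in [T]. *)
have TxE n : x ^+ n * T n = (n%:R * x ^+ n) * (n%:R^-1 * T n).
  case: n => [|n]; first by rewrite /T /series /= big_geq// !mulr0.
  by field; rewrite nat1r pnatr_eq0.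
have Tx0 : x ^+ n * T n @[n --> \oo] --> 0.
  rewrite (funext TxE) -[X in _ --> X](mul0r s).
  by apply: cvgM; [exact: cvg_natmul_expr|].
have Sx0 : x ^+ n * series a n @[n --> \oo] --> 0.
  have TBx0 : x ^+ n.+1 * T n.+1 - x * (x ^+ n * T n) @[n --> \oo] --> 0.
    rewrite -[X in _ --> X]subr0; apply: cvgB; last exact: cvgMl0.
    by have := Tx0; rewrite -cvg_shiftS.
  rewrite -cvg_shiftS; apply: cvg_trans TBx0; apply: near_eq_cvg.
  apply: nearW => n /=.
  have -> : T n.+1 = T n + series a n.+1 by rewrite /T {1}/series /= big_nat_recr.
  by rewrite exprS; ring.
have -> : series (fun k => x ^+ k * a k) = (fun n =>
    series (fun k => abel_weight x k * t k) n
      + (1 - x) * (x ^+ n * T n) + x ^+ n * series a n).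
  apply/funext => n; rewrite {1}/series /= sum_by_parts_power.
  rewrite (sum_by_parts_power (fun k => series a k.+1)) mulrDr; congr (_ + _ + _).
  rewrite mulrA -expr2 mulr_sumr /series /=; apply: eq_bigr => k _.
  rewrite /abel_weight /t -[RHS]mulrA; congr (_ * _).
  by rewrite [RHS]mulrACA divff ?pnatr_eq0// mul1r.
rewrite -[X in _ --> X]addr0; apply: cvgD Sx0.
by rewrite -[X in _ --> X]addr0; apply: cvgD; [exact: cvgt|exact: cvgMl0].
Qed.

(** Frobenius' theorem for real series. *)
Theorem cesaro_abel_real (R : realType) (a : R ^nat) (s : R) :
  n%:R^-1 * series (fun k => series a k.+1) n @[n --> \oo] --> s ->
  (forall x : R, 0 < x < 1 -> cvgn (series (fun k => x ^+ k * a k))) /\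
  limn (series (fun k => x ^+ k * a k)) @[x --> 1^'-] --> s.
Proof.
move=> cs; split=> [x x01|].
  exact: cvgP (partial_sums_cvg_abel_average cs x01).
have ts : n.+1%:R^-1 * series (fun k => series a k.+1) n.+1 @[n --> \oo] --> s.
  by move: cs; rewrite -cvg_shiftS.
apply: cvg_trans (abel_average_cvg ts); apply: near_eq_cvg.
near=> x.
have x01 : 0 < x < 1 by near: x; exact: near_left1.
by rewrite (cvg_lim _ (partial_sums_cvg_abel_average cs x01)).
Unshelve. all: by end_near. Qed.

(** * Convergence in coordinates *)

Lemma cvg_mxP (K : topologicalType) m n (T : Type) (F : set_system T)
    {FF : Filter F} (f : T -> 'M[K]_(m, n)) (M : 'M[K]_(m, n)) :
  f x @[x --> F] --> M <-> forall i j, f x i j @[x --> F] --> M i j.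
Proof.
split=> [fM i j B MB|fM B [P MP PB]].
  apply: (fM [set N | B (N i j)]).
  (* The box whose [(i, j)] side is [B] and whose other sides are everything. *)
  exists (fun i' j' => [set y | i' = i -> j' = j -> B y]).
    move=> i' j'; have [[-> ->]|ne] := pselect (i' = i /\ j' = j).
      by apply: filterS MB => y By.
    by apply: filterE => y i'i j'j; case: ne.
  by move=> N; exact.
apply: (filterS (P := fun x => forall i j, P i j (f x i j))) => [x|].
  exact: PB.
by do 2!apply: filter_forall => ?; exact: fM.
Qed.

Lemma normc_le_ReIm (R : realType) (z : R[i]) :
  `|z| <= (`|complex.Re z| + `|complex.Im z|)%:C.
Proof.
rewrite normc_def lecR -[leRHS]ger0_norm ?addr_ge0// -sqrtr_sqr ler_sqrt ?sqr_ge0//.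
rewrite sqrrD !real_normK ?num_real// lerD2r lerDl.
by rewrite mulrn_wge0// mulr_ge0.
Qed.

Lemma normc_ge_Im (R : realType) (z : R[i]) : `|complex.Im z|%:C <= `|z|.
Proof.
by rewrite normc_def lecR -sqrtr_sqr ler_sqrt ?addr_ge0 ?sqr_ge0// lerDr sqr_ge0.
Qed.

Lemma cvg_complexP (R : realType) (T : Type) (F : set_system T) {FF : Filter F}
    (f : T -> R[i]) (z : R[i]) :
  f x @[x --> F] --> z <->
  complex.Re (f x) @[x --> F] --> complex.Re z /\
  complex.Im (f x) @[x --> F] --> complex.Im z.
Proof.
split=> [/cvgrPdist_lt fz|[/cvgrPdist_lt fRe /cvgrPdist_lt fIm]].
  split; apply/cvgrPdist_lt => e e0.
    have /fz : 0 < e%:C by rewrite ltcR.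
    apply: filterS => x; rewrite -ltcR; apply: le_lt_trans.
    by rewrite -raddfB; exact: normc_ge_Re.
  have /fz : 0 < e%:C by rewrite ltcR.
  apply: filterS => x; rewrite -ltcR; apply: le_lt_trans.
  by rewrite -raddfB; exact: normc_ge_Im.
apply/cvgrPdist_lt => e e0.
(* A positive complex number is real. *)
have eE : e = (complex.Re e)%:C by rewrite RRe_real// gtr0_real.
rewrite eE ltcR in e0.
have e20 : 0 < complex.Re e / 2 by rewrite divr_gt0.
near=> x.
rewrite eE; apply: le_lt_trans (normc_le_ReIm _) _.
rewrite ltcR !raddfB [ltRHS]splitr ltrD//; near: x; [exact: fRe|exact: fIm].
Unshelve. all: by end_near. Qed.

(** * Reduction of the matrix case to the real case *)

(** [p] stands for the real part or the imaginary part; being additive and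
compatible with real scalars is all that the summation methods see of it. *)
Section real_coordinates.
Variables (R : realType) (d : nat) (p : {additive R[i] -> R}).
Hypothesis pZ : forall (r : R) z, p (r%:C * z) = r * p z.
Implicit Types (A : nat -> 'M[R[i]]_d).

Lemma coord_partial_sum A i j n :
  p (partial_sum A n i j) = series (fun k => p (A k i j)) n.+1.
Proof. by rewrite /partial_sum summxE raddf_sum. Qed.

Lemma coord_cesaro_mean A i j n :
  p (cesaro_mean A n i j) =
  n%:R^-1 * series (fun k => series (fun k => p (A k i j)) k.+1) n.
Proof.
rewrite /cesaro_mean mxE.
have -> : n%:R^-1 = (n%:R^-1)%:C :> R[i] by rewrite fmorphV rmorph_nat.
rewrite pZ summxE raddf_sum; congr (_ * _).
by apply: eq_bigr => k _; rewrite coord_partial_sum.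
Qed.

Lemma coord_power_sum A x i j n :
  p (partial_sum (power_term A x) n i j) =
  series (fun k => x ^+ k * p (A k i j)) n.+1.
Proof.
rewrite coord_partial_sum /series /=; apply: eq_bigr => k _.
by rewrite /power_term mxE pZ.
Qed.

(** The limit is given as an explicit function of x, so that the limits of the
coordinates can be assembled into a matrix without any choice. *)
Lemma coord_cesaro_abel A (S : 'M[R[i]]_d) i j :
  let f x := limn (series (fun k => x ^+ k * p (A k i j))) in
  p (cesaro_mean A n i j) @[n --> \oo] --> p (S i j) ->
  (forall x, 0 < x < 1 ->
     p (partial_sum (power_term A x) n i j) @[n --> \oo] --> f x) /\
  f x @[x --> 1^'-] --> p (S i j).
Proof.
move=> f; under eq_fun do rewrite coord_cesaro_mean.
move=> /cesaro_abel_real[cvgf limf]; split=> // x x01.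
under eq_fun do rewrite coord_power_sum.
by have := cvgf x x01; rewrite -cvg_shiftS.
Qed.

End real_coordinates.

Theorem theorem4p5 (R : realType) (d : nat) (A : nat -> 'M[R[i]]_d)
    (S : 'M[R[i]]_d) :
  cesaro_summable A S -> abel_summable A S.
Proof.
move=> /cvg_mxP AS.
have ReZ (r : R) z : complex.Re (r%:C * z) = r * complex.Re z.
  by case: z => a b /=; rewrite mul0r subr0.
have ImZ (r : R) z : complex.Im (r%:C * z) = r * complex.Im z.
  by case: z => a b /=; rewrite mul0r addr0.
pose G x : 'M[R[i]]_d := \matrix_(i, j)
  (limn (series (fun k => x ^+ k * complex.Re (A k i j))) +i*
   limn (series (fun k => x ^+ k * complex.Im (A k i j)))).
have cvgG x : 0 < x < 1 -> partial_sum (power_term A x) @ \oo --> G x.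
  move=> x01; apply/cvg_mxP => i j; apply/cvg_complexP; rewrite mxE.
  have /cvg_complexP[ASre ASim] := AS i j.
  by have [/(_ x x01)? _] := coord_cesaro_abel ReZ ASre;
    have [/(_ x x01)? _] := coord_cesaro_abel ImZ ASim.
split=> [x x01|]; first exact: cvgP (cvgG x x01).
have limG : G x @[x --> (1 : R)^'-] --> S.
  apply/cvg_mxP => i j; apply/cvg_complexP.
  have /cvg_complexP[ASre ASim] := AS i j.
  split; under eq_fun do rewrite mxE.
    by have [] := coord_cesaro_abel ReZ ASre.
  by have [] := coord_cesaro_abel ImZ ASim.
apply: cvg_trans limG; apply: near_eq_cvg.
near=> x.
have x01 : 0 < x < 1 by near: x; exact: near_left1.
by rewrite /power_sum (cvg_lim _ (cvgG x x01)).
Unshelve. all: by end_near. Qed.
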